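(* Let $a,b,c$ be real numbers with $2<a\le b\le c<ab/2$ and $a^2+b^2+c^2=abc$. Let $J$ be the closed segment of length $a$ on the line $Y=a/2$ that runs from the left endpoint of the excision interval of $S^{-a}T_2S^{a}$ to the left endpoint of the excision interval of $T_2$. Then the complement in $J$ of the union of the excision intervals of all $T\in\mathcal I$ has Hausdorff dimension zero.
   Context: $\mathcal H$ is the upper half plane with points $X+iY$, $Y>0$; matrices in $\mathrm{SL}(2,\mathbb R)$ act by Möbius transformations and are considered up to sign. $S^a$ is the translation $z\mapsto z+a$. $T_0=\begin{pmatrix}0&-a/c\\ c/a&0\end{pmatrix}$, $T_1=\begin{pmatrix}a/c&*\\ b/a&-a/c\end{pmatrix}$, $T_2=\begin{pmatrix}a-b/c&*\\ 1&-a+b/c\end{pmatrix}$, where each $*$ is determined by determinant one; these generate a Fuchsian group of signature $(0;2,2,2;\infty)$ and $T_2T_1T_0=S^a$. Uplift regions: for $A=\begin{pmatrix}\alpha&\beta\\ \gamma&-\alpha\end{pmatrix}\in\mathrm{SL}(2,\mathbb R)$, $\mathcal U(A)=\{X+iY\in\mathcal H : |(X-\alpha/\gamma)^2-Y^2|<1/\gamma^2\}$; $\mathcal U_-(A)$ is the set of points of $\mathcal U(A)$ with $X<\alpha/\gamma$, and $\mathcal U_+(A)=\mathcal U(A)\setminus\mathcal U_-(A)$. The excision interval of $A$ is the intersection of the line $Y=a/2$ with $\mathcal U_+(A)\cup\mathcal U_-(S^aAS^{-a})$. Tree of triples: $\nu(E,F,G)=(FEF,\,G,\,S^aFS^{-a})$,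 $\rho(E,F,G)=(FGF,\,F,\,S^aES^{-a})$, $\lambda(E,F,G)=(EFE,\,E,\,G)$. The tree $\mathcal T^{\nu}_{\lambda,\rho}$ has as nodes all triples obtained by applying finite (possibly empty) compositions of $\lambda$ and $\rho$ to $(T_0,T_1,T_2)$ or to $\nu(T_0,T_1,T_2)$. Let $\mathcal I$ be the set consisting of $T_1$, $S^{-a}T_2S^{a}$, and the first entries $E$ of all nodes $(E,F,G)$ of $\mathcal T^{\nu}_{\lambda,\rho}$. *)

(* Defs.v *)
From mathcomp Require Import all_boot all_order all_algebra.
From mathcomp Require Import complex.
From mathcomp Require Import all_classical all_reals all_analysis.

Set Implicit Arguments.
Unset Strict Implicit.
Unset Printing Implicit Defensive.

Import Order.TTheory GRing.Theory Num.Theory.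
Import numFieldNormedType.Exports.

Local Open Scope classical_set_scope.
Local Open Scope ring_scope.

Section Hausdorff.
Context {R : realType} {T : Type}.
Variable d : T -> T -> R.
Local Open Scope ereal_scope.

(* The extra element 0 makes the diameter of the empty set 0 rather than the
   supremum -oo of the empty set. *)
Definition diam (A : set T) : \bar R :=
  ereal_sup (0 |` [set (d p.1 p.2)%:E | p in A `*` A]).

(* Finite covers are included, padded with empty sets. *)
Definition countable_cover (delta : R) (A : set T) : set (nat -> set T) :=
  [set U | A `<=` \bigcup_i U i /\ forall i, diam (U i) <= delta%:E].

Definition hausdorff_premeasure (s delta : R) (A : set T) : \bar R :=
  ereal_inf [set \sum_(0 <= i <oo) (diam (U i)) `^ s
            | U in countable_cover delta A].

(* Meant for 0 < s only: x `^ 0 = 1 also for x = 0, so at s = 0 empty members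
   of a cover would be counted. *)
Definition hausdorff_measure (s : R) (A : set T) : \bar R :=
  ereal_sup [set hausdorff_premeasure s delta A
            | delta in [set delta : R | (0 < delta)%R]].

Definition hausdorff_dim (A : set T) : \bar R :=
  ereal_inf [set s%:E
            | s in [set s : R | (0 < s)%R /\ hausdorff_measure s A = 0]].

End Hausdorff.

Section Uplift.
Variable R : realType.

Definition dist_plane (z w : R[i]) : R := ComplexField.Normc.normc (z - w).

Definition upper_half_plane : set R[i] := [set z | 0 < complex.Im z].

Definition mx2 (p q r s : R) : 'M[R]_2 :=
  \matrix_(i, j) if i == 0 then if j == 0 then p else q
                 else if j == 0 then r else s.

(* Elements of SL(2,R) up to sign are handled through matrix representatives;
   the regions below are unchanged under A |-> - A. *)

Definition translation (t : R) : 'M[R]_2 := mx2 1 t 0 1.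

(* S^t A S^(-t) *)
Definition translate_conj (t : R) (A : 'M[R]_2) : 'M[R]_2 :=
  translation t *m A *m translation (- t).

(* The matrix (alpha, *; gamma, - alpha) of determinant one. *)
Definition half_turn (alpha gamma : R) : 'M[R]_2 :=
  mx2 alpha (- (1 + alpha ^+ 2) / gamma) gamma (- alpha).

(* alpha / gamma for A = (alpha, beta; gamma, - alpha) *)
Definition center_abscissa (A : 'M[R]_2) : R := A 0 0 / A 1 0.

Definition uplift (A : 'M[R]_2) : set R[i] :=
  [set z | upper_half_plane z /\
     `|(complex.Re z - center_abscissa A) ^+ 2 - complex.Im z ^+ 2|
       < 1 / A 1 0 ^+ 2].

Definition uplift_minus (A : 'M[R]_2) : set R[i] :=
  uplift A `&` [set z | complex.Re z < center_abscissa A].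

Definition uplift_plus (A : 'M[R]_2) : set R[i] :=
  uplift A `\` uplift_minus A.

Definition excision_line (a : R) : set R[i] := [set z | complex.Im z = a / 2].

Definition excision (a : R) (A : 'M[R]_2) : set R[i] :=
  excision_line a `&` (uplift_plus A `|` uplift_minus (translate_conj a A)).

Definition excision_left (a : R) (A : 'M[R]_2) : R :=
  inf (@complex.Re R @` excision a A).

Definition T0 (a c : R) : 'M[R]_2 := mx2 0 (- (a / c)) (c / a) 0.
Definition T1 (a b c : R) : 'M[R]_2 := half_turn (a / c) (b / a).
Definition T2 (a b c : R) : 'M[R]_2 := half_turn (a - b / c) 1.

Definition triple : Type := 'M[R]_2 * 'M[R]_2 * 'M[R]_2.

Definition tree_nu (a : R) (t : triple) : triple :=
  let: (E, F, G) := t in (F *m E *m F, G, translate_conj a F).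

Definition tree_rho (a : R) (t : triple) : triple :=
  let: (E, F, G) := t in (F *m G *m F, F, translate_conj a E).

Definition tree_lambda (t : triple) : triple :=
  let: (E, F, G) := t in (E *m F *m E, E, G).

Definition root_triple (a b c : R) : triple := (T0 a c, T1 a b c, T2 a b c).

Inductive tree_node (a b c : R) : triple -> Prop :=
| tree_node_root : tree_node a b c (root_triple a b c)
| tree_node_nu : tree_node a b c (tree_nu a (root_triple a b c))
| tree_node_lambda t : tree_node a b c t -> tree_node a b c (tree_lambda t)
| tree_node_rho t : tree_node a b c t -> tree_node a b c (tree_rho a t).

Definition excisors (a b c : R) : set 'M[R]_2 :=
  [set T1 a b c; translate_conj (- a) (T2 a b c)] `|`
  [set t.1.1 | t in tree_node a b c].

Definition segment_J (a b c : R) : set R[i] :=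
  excision_line a `&`
  [set z | excision_left a (translate_conj (- a) (T2 a b c)) <= complex.Re z
             <= excision_left a (T2 a b c)].

End Uplift.

(* Main.v *)
(** If [(E, F, G)] is a node and [x, y, z] are [a] times the absolute values of
    the lower left entries of [E, F, G], then [x^2 + y^2 + z^2 = x y z], and
    [lambda], [rho], [nu] act as Vieta jumps, while each centre is determined by
    the previous one ([p_F - p_E = a z / (x y)], [p_G - p_F = a x / (y z)]).
    The excision interval of [E] splits the gap between those of [S^-a G S^a]
    and [F] into the gaps of [lambda (E, F, G)] and [rho (E, F, G)].
    The length of a gap is O(1 / (y z)^2), and every new entry is at least half
    the product of two old ones.  Put [u = (4 / y^2)^s] and [v = (4 / z^2)^s]:
    up to a constant factor, the sum over depth [n] of the [s]-th powers of the
    gap lengths is at most the depth-[n] part of the sum of [u^m v^k] over all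
    [m, k > 0], arranged along the Euclidean algorithm.  The latter converges
    for every [s > 0], so its depth-[n] part tends to [0]. *)

Require Import Defs.
From mathcomp Require Import all_boot all_order all_algebra.
From mathcomp Require Import complex.
From mathcomp Require Import all_classical all_reals all_analysis.
From mathcomp Require Import ring lra.

Set Implicit Arguments.
Unset Strict Implicit.
Unset Printing Implicit Defensive.

Import Order.TTheory GRing.Theory Num.Theory.
Import numFieldNormedType.Exports.

Local Open Scope classical_set_scope.
Local Open Scope ring_scope.

(** * Half turns and their conjugates *)

(* [A] is, up to sign, a half turn with centre abscissa [p] and lower left
   entry [x / a]; the products [A B A] change the sign of that entry. *)
Definition half_turn_at (R : realType) (a p x : R) (A : 'M[R]_2) : Prop :=
  exists2 g : R, `|g| = x / a & A = half_turn (p * g) g.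

Lemma half_turn_at_translate (R : realType) (a p x t : R) A : 0 < a -> 0 < x ->
  half_turn_at a p x A -> half_turn_at a (p + t) x (translate_conj t A).
Proof.
move=> a0 x0 [g gx ->]; exists g => //.
have g0 : g != 0 by rewrite -normr_gt0 gx divr_gt0.
apply/matrixP => i j; rewrite !mxE /= !big_ord_recl !big_ord0 !mxE /=.
rewrite !big_ord_recl !big_ord0 !mxE /=.
case: i => [[|[|//]] Hi]; case: j => [[|[|//]] Hj] /=; by field.
Qed.

(** [A] is its own inverse up to sign, so [A B A] is the half turn about the image under [A] of the
    fixed point [q + i a / y] of [B]. The equation for [x'] says that this image has height
    [a / x']. *)
Lemma half_turn_at_conj (R : realType) (a p q x y x' : R) A B :
  0 < a -> 0 < x -> 0 < y -> 0 < x' ->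
  x' * y * a ^+ 2 = x ^+ 2 * (y ^+ 2 * (q - p) ^+ 2 + a ^+ 2) ->
  half_turn_at a p x A -> half_turn_at a q y B ->
  half_turn_at a (p - (q - p) * y / x') x' (A *m B *m A).
Proof.
move=> a0 x0 y0 x'0 ex' [e ex ->] [f fy ->].
have e0 : e != 0 by rewrite -normr_gt0 ex divr_gt0.
have f0 : f != 0 by rewrite -normr_gt0 fy divr_gt0.
have e2 : e ^+ 2 = x ^+ 2 / a ^+ 2 by rewrite -real_normK ?num_real// ex expr_div_n.
have f2 : f ^+ 2 = y ^+ 2 / a ^+ 2 by rewrite -real_normK ?num_real// fy expr_div_n.
have a_n0 := lt0r_neq0 a0; have x_n0 := lt0r_neq0 x0.
have y_n0 := lt0r_neq0 y0; have x'_n0 := lt0r_neq0 x'0.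
set D := f ^+ 2 * (q - p) ^+ 2 + 1.
have eD : e ^+ 2 * D = x' * y / a ^+ 2.
  rewrite /D e2 f2; have -> : x' * y / a ^+ 2 = x' * y * a ^+ 2 / a ^+ 2 / a ^+ 2 by field.
  by rewrite ex'; field.
have D0 : D != 0.
  apply: contraTneq x'0 => D0; move: eD; rewrite D0 mulr0 => /esym/eqP.
  rewrite !mulf_eq0 invr_eq0 expf_eq0 /= (negbTE a_n0) (negbTE y_n0) !orbF.
  by move=> /eqP ->; rewrite ltxx.
have -> : (q - p) * y / x' = (q - p) * f ^+ 2 / (e ^+ 2 * D).
  by rewrite eD f2; field; rewrite x'_n0 y_n0 a_n0.
exists (- (e ^+ 2 * D / f)).
  rewrite normrN normrM normfV eD fy gtr0_norm ?divr_gt0 ?mulr_gt0 ?exprn_gt0//.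
  by field; rewrite y_n0 a_n0.
have D0' : f ^+ 2 * (q - p) ^+ 2 + 1 != 0 by [].
rewrite /D.
apply/matrixP => i j; rewrite !mxE /= !big_ord_recl !big_ord0 !mxE /=.
rewrite !big_ord_recl !big_ord0 !mxE /=.
by case: i => [[|[|//]] Hi]; case: j => [[|[|//]] Hj] /=; field; rewrite ?f0 ?e0 ?exprMn ?D0'.
Qed.

(** * Excision intervals on the line [Y = a / 2] *)

(* Half the length of the excision interval, that is, the smaller root of
   [r (a - r) = 1 / gamma^2] with [gamma = y / a]. *)
Definition rad (R : realType) (a y : R) : R := a / 2 * (1 - Num.sqrt (1 - 4 / y ^+ 2)).

Lemma sqr_sqrt_rad (R : realType) (y : R) : 2 <= y ->
  Num.sqrt (1 - 4 / y ^+ 2) ^+ 2 = 1 - 4 / y ^+ 2.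
Proof.
move=> y2; have y0 : 0 < y ^+ 2 by rewrite exprn_gt0//; lra.
by rewrite sqr_sqrtr// subr_ge0 ler_pdivrMr// mul1r; nra.
Qed.

Lemma rad_mul (R : realType) (a y : R) : 2 <= y ->
  rad a y * (a - rad a y) = a ^+ 2 / y ^+ 2.
Proof.
move=> y2; have := sqr_sqrt_rad y2; rewrite /rad; set w := Num.sqrt _ => w2.
have -> : a ^+ 2 / y ^+ 2 = a ^+ 2 / 4 * (4 / y ^+ 2).
  by field; rewrite gt_eqF//; lra.
have -> : 4 / y ^+ 2 = 1 - w ^+ 2 by rewrite w2; ring.
by field.
Qed.

Lemma rad_gt0 (R : realType) (a y : R) : 0 < a -> 2 <= y -> 0 < rad a y.
Proof.
move=> a0 y2; rewrite /rad mulr_gt0 ?divr_gt0// subr_gt0.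
have y0 : 0 < 4 / y ^+ 2 by rewrite divr_gt0 ?exprn_gt0//; lra.
rewrite -[ltRHS]sqrtr1 ltr_sqrt //; lra.
Qed.

Lemma rad_le (R : realType) (a y : R) : 0 < a -> rad a y <= a / 2.
Proof.
move=> a0; rewrite /rad ler_piMr ?divr_ge0 ?(ltW a0)// gerBl sqrtr_ge0//.
Qed.

(** With [t = X - p >= 0] and [r = rad a x], the plus part is
    [(a/2 - r)^2 < t^2 < a^2/4 + r (a - r)]. It contains the left half of the interval with its
    midpoint, and stays inside since the upper bound is below [(a/2 + r)^2]. The minus part is its
    mirror image. *)
Lemma excisionE (R : realType) (a p x : R) A : 0 < a -> 2 <= x ->
  half_turn_at a p x A ->
  excision a A = excision_line a `&` [set z | `|complex.Re z - (p + a / 2)| < rad a x].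
Proof.
move=> a0 x2 hA.
have x0 : 0 < x by lra.
have [g gx eA] := hA.
have [g' g'x eA'] := half_turn_at_translate a a0 x0 hA.
have rm := rad_mul a x2; have r0 := rad_gt0 a0 x2; have rle := rad_le x a0.
have g2 (h : R) : `|h| = x / a -> 1 / h ^+ 2 = a ^+ 2 / x ^+ 2.
  move=> hx; rewrite -real_normK ?num_real// hx expr_div_n.
  by field; rewrite !gt_eqF.
have c (h s : R) : `|h| = x / a -> center_abscissa (half_turn (s * h) h) = s.
  move=> hx; rewrite /center_abscissa !mxE /= mulfK//.
  by rewrite -normr_gt0 hx divr_gt0.
have h10 (h s : R) : (half_turn (s * h) h) 1 0 = h by rewrite !mxE.
apply/seteqP; split=> z [/= zl] H; split=> //; move: H;
  rewrite /uplift_plus /uplift_minus /uplift /= /upper_half_plane /=.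
  rewrite /excision_line/= in zl.
  rewrite eA' eA !c// !h10 !g2// -rm zl.
  rewrite not_andE => -[[[_ zA] zB]|[[_ zA] zB]].
    have {}zB : p <= complex.Re z.
      case: zB => [zB|/negP]; last by rewrite -leNgt.
      by exfalso; apply: zB; split=> //; lra.
    move: zA; rewrite !ltr_norml => /andP[z1 z2]; nra.
  move: zA; rewrite !ltr_norml => /andP[z1 z2]; nra.
rewrite /excision_line/= in zl.
rewrite eA' eA !c// !h10 !g2// -rm zl ltr_norml => /andP[z1 z2].
have [zr|zr] := lerP (complex.Re z) (p + a / 2); [left|right].
- split; last by move=> [_]; apply/negP; rewrite -leNgt; lra.
  split; first lra.
  by rewrite ltr_norml; apply/andP; split; nra.
- split; last lra.
  split; first lra.
  by rewrite ltr_norml; apply/andP; split; nra.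
Qed.

Lemma excision_leftE (R : realType) (a p x : R) A : 0 < a -> 2 <= x ->
  half_turn_at a p x A -> excision_left a A = p + a / 2 - rad a x.
Proof.
move=> a0 x2 hA; rewrite /excision_left (excisionE a0 x2 hA).
have r0 := rad_gt0 a0 x2.
rewrite (_ : _ @` _ = [set` `]p + a / 2 - rad a x, p + a / 2 + rad a x[]).
  by rewrite inf_itv// bnd_simp; lra.
apply/seteqP; split=> [t [z [_ /=]]|t /=].
  by rewrite ltr_norml in_itv/= => /andP[z1 z2] <-; apply/andP; split; lra.
rewrite in_itv/= => /andP[t1 t2]; exists (Complex t (a / 2)) => //.
split=> //=; rewrite ltr_norml; apply/andP; split; lra.
Qed.

(** * Finite covers and Hausdorff dimension zero *)

(* Covers are finite here: residual sets are covered by the gaps of one depth. *)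
Definition s_coverable (R : realType) (T : Type) (d : T -> T -> R) (s M : R)
    (A : set T) : Prop :=
  exists2 Us : seq (set T), A `<=` \big[setU/set0]_(U <- Us) U &
    (\sum_(U <- Us) diam d U `^ s <= M%:E)%E.

Lemma s_coverableU (R : realType) (T : Type) (d : T -> T -> R) (s M N : R)
    (A B : set T) :
  s_coverable d s M A -> s_coverable d s N B -> s_coverable d s (M + N) (A `|` B).
Proof.
move=> [Us AU UM] [Vs BV VN]; exists (Us ++ Vs); first by rewrite big_cat; exact: setUSS.
by rewrite big_cat EFinD; exact: leeD.
Qed.

Lemma s_coverableS (R : realType) (T : Type) (d : T -> T -> R) (s M N : R)
    (A B : set T) :
  M <= N -> A `<=` B -> s_coverable d s M B -> s_coverable d s N A.
Proof.
move=> MN AB [Us BU UM]; exists Us; first exact: subset_trans BU.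
by apply: le_trans UM _; rewrite lee_fin.
Qed.

Lemma diam_ge0 (R : realType) (T : Type) (d : T -> T -> R) (A : set T) :
  (0 <= diam d A)%E.
Proof. by apply: ereal_sup_ubound; left. Qed.

Lemma diam_set0 (R : realType) (T : Type) (d : T -> T -> R) : diam d set0 = 0%E.
Proof.
apply/eqP; rewrite eq_le diam_ge0 andbT; apply: ge_ereal_sup => _ [->//|[p [[]]]].
Qed.

Lemma diam_le (R : realType) (T : Type) (d : T -> T -> R) (A : set T) (L : R) :
  0 <= L -> (forall z w, A z -> A w -> d z w <= L) -> (diam d A <= L%:E)%E.
Proof.
move=> L0 AL; apply: ge_ereal_sup => _ [->|[[z w] [/= Az Aw] <-]]; rewrite lee_fin//.
exact: AL.
Qed.

Lemma s_coverable1 (R : realType) (T : Type) (d : T -> T -> R) (s L : R) (A : set T) :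
  0 <= s -> 0 <= L -> (forall z w, A z -> A w -> d z w <= L) ->
  s_coverable d s (L `^ s) A.
Proof.
move=> s0 L0 AL; exists [:: A]; rewrite big_seq1//.
rewrite -poweR_EFin gt0_ler_poweR ?diam_le// in_itv/= leey andbT ?diam_ge0//.
Qed.

(** A small sum forces a fine cover: if the [s]-th powers of the diameters add up to less than
    [delta ^ s], every diameter is at most [delta]. *)
Lemma hausdorff_dim0 (R : realType) (T : Type) (d : T -> T -> R) (A : set T) :
  (forall s e : R, 0 < s -> 0 < e -> s_coverable d s e A) ->
  hausdorff_dim d A = 0%E.
Proof.
move=> cA.
have H0 (s : R) : 0 < s -> hausdorff_measure d s A = 0%E.
  move=> s0.
  suff P0 delta : 0 < delta -> hausdorff_premeasure d s delta A = 0%E.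
    apply/eqP; rewrite eq_le; apply/andP; split.
      by apply: ge_ereal_sup => _ [delta /P0-> <-].
    by apply: ereal_sup_ubound; exists 1 => //=; exact: P0.
  move=> delta0; apply/eqP; rewrite eq_le; apply/andP; split; last first.
    apply: le_ereal_inf_tmp => _ [U _ <-].
    by apply: nneseries_ge0 => i _ _; exact: poweR_ge0.
  apply/lee_addgt0Pr => e e0; rewrite add0e.
  pose m := Num.min e (delta `^ s / 2).
  have ds0 : 0 < delta `^ s by exact: powR_gt0.
  have m0 : 0 < m by rewrite lt_min e0 divr_gt0.
  have [Us AU UM] := cA s m s0 m0.
  pose U i := nth set0 Us i.
  have ge i : (0 <= diam d (U i) `^ s)%E by exact: poweR_ge0.
  have Us_le : (\sum_(0 <= i <oo) diam d (U i) `^ s <= m%:E)%E.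
    (* The padding sets are empty and add [0 ^ s = 0], as [s > 0]. *)
    rewrite (nneseries_split _ (size Us)) ?add0n// eseries0 ?adde0; last first.
      by move=> i iU _; rewrite /U nth_default// diam_set0 poweR0r ?gt_eqF.
    by apply: le_trans UM; rewrite (big_nth set0).
  apply: ge_ereal_inf; exists (\sum_(0 <= i <oo) diam d (U i) `^ s)%E; last first.
    by apply: le_trans Us_le _; rewrite lee_fin ge_min lexx.
  exists U => //; split.
    apply: subset_trans AU _; rewrite (big_nth set0) big_mkord -bigcup_mkord.
    by move=> z [i _ Uz]; exists i.
  move=> i; rewrite leNgt; apply/negP => di.
  have : (diam d (U i) `^ s <= m%:E)%E.
    apply: le_trans Us_le; apply: le_trans (nneseries_lim_ge i.+1 _) => //.
    by rewrite big_nat_recr//= leeDr// sume_ge0.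
  apply/negP; rewrite -ltNge.
  apply: (@lt_le_trans _ _ (delta%:E `^ s)%E).
    rewrite poweR_EFin lte_fin gt_min; apply/orP; right; lra.
  apply: gt0_ler_poweR; rewrite ?ltW// in_itv/= leey andbT ?diam_ge0// lee_fin ltW//.
apply/eqP; rewrite eq_le; apply/andP; split.
  apply/lee_addgt0Pr => e e0; rewrite add0e; apply: ereal_inf_lbound.
  by exists e => //; split=> //; exact: H0.
by apply: le_ereal_inf_tmp => _ [s [s0 _] <-]; rewrite lee_fin ltW.
Qed.

(** * Sums over the levels of the Euclidean tree *)

(** The monomials [u^m v^k] that occur belong to the coprime pairs [(m, k)] at depth [n] of the
    Stern-Brocot tree. *)
Fixpoint leafsum (R : realType) (n : nat) (u v : R) : R :=
  if n is m.+1 then leafsum m (u * v) v + leafsum m u (u * v) else u * v.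

Lemma leafsum_le (R : realType) n (u v u' v' : R) : 0 <= u -> 0 <= v ->
  u <= u' -> v <= v' -> leafsum n u v <= leafsum n u' v'.
Proof.
elim: n u v u' v' => [|n IH] u v u' v' u0 v0 uu vv /=; first exact: ler_pM.
by rewrite lerD// IH ?mulr_ge0// ler_pM.
Qed.

(* [u v / ((1 - u) (1 - v))] is the sum of [u^m v^k] over [m, k > 0]; the
   recursion splits it into the parts [m > k], [m = k] and [m < k]. *)
Lemma leafsum_sum_le (R : realType) n (u v : R) : 0 < u < 1 -> 0 < v < 1 ->
  \sum_(k < n) leafsum k u v <= u * v / ((1 - u) * (1 - v)).
Proof.
elim: n u v => [|n IH] u v /andP[u0 u1] /andP[v0 v1].
  by rewrite big_ord0 divr_ge0 ?mulr_ge0//; lra.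
rewrite big_ord_recl /= big_split /=.
have uv0 : 0 < u * v by rewrite mulr_gt0.
have uv1 : u * v < 1 by rewrite mulr_ilt1// ltW.
have := IH (u * v) v; have := IH u (u * v); rewrite u0 u1 v0 v1 uv0 uv1.
move=> /(_ isT isT) h1 /(_ isT isT) h2.
have -> : u * v / ((1 - u) * (1 - v)) =
    u * v / (1 - u * v) + u * v * v / ((1 - u * v) * (1 - v))
    + u * (u * v) / ((1 - u) * (1 - u * v)).
  by field; rewrite !gt_eqF// subr_gt0.
have : u * v <= u * v / (1 - u * v).
  by rewrite ler_pdivlMr ?subr_gt0// ler_piMr ?ltW//; lra.
by move=> ?; rewrite -addrA; apply: lerD => //; exact: lerD.
Qed.

Lemma small_term (R : realType) (f : nat -> R) (M e : R) : 0 < e ->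
  (forall n, \sum_(k < n) f k <= M) -> exists k, f k < e.
Proof.
move=> e0 fM; apply/not_existsP => fe.
have lb n : n%:R * e <= M.
  apply: le_trans (fM n); rewrite mulr_natl -[leLHS](_ : \sum_(k < n) e = _).
    by apply: ler_sum => k _; rewrite leNgt; apply/negP/fe.
  by rewrite sumr_const card_ord.
have M0 : 0 <= M by have := fM 0; rewrite big_ord0.
have := lb (Num.bound (M / e)).
have := archi_boundP (divr_ge0 M0 (ltW e0)).
by rewrite ltr_pdivrMr// => h1 h2; have := lt_le_trans h1 h2; rewrite ltxx.
Qed.

(** * Gap lengths *)

(* [y z <= 2 x] says that [x] is the larger root of the Markoff equation, i.e.
   [2 x / (y z) = 1 + sqrt (1 - 4 / y^2 - 4 / z^2)]; then the first-order terms
   of the gap length in [4 / y^2] and [4 / z^2] cancel. *)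
Lemma gap_length (R : realType) (a x y z : R) : 2 < a -> a <= y -> a <= z ->
  x ^+ 2 + y ^+ 2 + z ^+ 2 = x * y * z -> y * z <= 2 * x ->
  a - a * x / (y * z) - rad a y - rad a z
    <= a / (1 - 4 / a ^+ 2) * (4 / y ^+ 2 * (4 / z ^+ 2)).
Proof.
move=> a2 ay az markoff yzx; rewrite /rad.
have [y2 z2] : 2 <= y /\ 2 <= z by split; lra.
have a0 : 0 < a by lra.
have y0 : 0 < y by lra.
have z0 : 0 < z by lra.
have := sqr_sqrt_rad y2; have := sqr_sqrt_rad z2.
have := sqrtr_ge0 (1 - 4 / y ^+ 2); have := sqrtr_ge0 (1 - 4 / z ^+ 2).
set w := Num.sqrt _; set v := Num.sqrt _ => w0 v0 w2 v2.
have inv_le t : a <= t -> 4 / t ^+ 2 <= 4 / a ^+ 2.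
  move=> at_; rewrite ler_pM2l// lef_pV2 ?posrE ?exprn_gt0//; last by lra.
  by rewrite ler_sqr ?nnegrE//; lra.
have k0 : 0 < 1 - 4 / a ^+ 2.
  by rewrite subr_gt0 ltr_pdivrMr ?exprn_gt0// mul1r; nra.
have := inv_le y ay; have := inv_le z az.
have : 0 < 4 / y ^+ 2 by rewrite divr_gt0 ?exprn_gt0.
have : 0 < 4 / z ^+ 2 by rewrite divr_gt0 ?exprn_gt0.
pose m := 2 * x / (y * z) - 1.
have m0 : 0 <= m by rewrite subr_ge0 ler_pdivlMr ?mulr_gt0// mul1r.
have m2 : m ^+ 2 = 1 - 4 / y ^+ 2 - 4 / z ^+ 2.
  have -> : m ^+ 2 = 1 - 4 / (y * z) ^+ 2 * (x * y * z - x ^+ 2).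
    by rewrite /m; field; rewrite !gt_eqF.
  by rewrite -markoff; field; rewrite !gt_eqF.
have -> : a * x / (y * z) = a / 2 * (m + 1).
  by rewrite /m; field; rewrite !gt_eqF.
move: v2 w2 m2 k0; set k := 1 - 4 / a ^+ 2; rewrite (_ : 4 / a ^+ 2 = 1 - k); last first.
  by rewrite /k; ring.
move: (4 / y ^+ 2) (4 / z ^+ 2) => S T v2 w2 m2 k0 T0 S0 Tk Sk.
have kvw : k <= v * w.
  rewrite -ler_sqr ?nnegrE ?mulr_ge0 ?(ltW k0)// exprMn w2 v2 expr2.
  by apply: ler_pM; lra.
have vw0 : 0 <= v * w by rewrite mulr_ge0.
(* [(v w)^2 - m^2 = S T] and [(v + w)^2 - (1 + m)^2 = 2 (v w - m)]. *)
have prod : (v + w - 1 - m) * ((v + w + 1 + m) * (v * w + m)) = 2 * (S * T).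
  transitivity (2 * ((v * w) ^+ 2 - m ^+ 2) + (v ^+ 2 + w ^+ 2 - 1 - m ^+ 2) * (v * w + m)).
    by ring.
  by rewrite exprMn w2 v2 m2; ring.
have le2 : v + w - 1 - m <= 2 * (S * T) / k.
  rewrite ler_pdivlMr// -prod.
  have [d0|d0] := lerP 0 (v + w - 1 - m).
    rewrite ler_wpM2l//; apply: (@le_trans _ _ (1 * (v * w + m))); first lra.
    by rewrite ler_wpM2r//; lra.
  (* This case is void: in [prod] the cofactor and [S * T] are positive. *)
  by rewrite ler_wnM2l ?ltW//; nra.
have -> : a - a / 2 * (m + 1) - a / 2 * (1 - v) - a / 2 * (1 - w) =
  a / 2 * (v + w - 1 - m) by field.
have -> : a / k * (S * T) = a / 2 * (2 * (S * T) / k) by field; rewrite gt_eqF.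
by rewrite ler_pM2l// divr_gt0.
Qed.

(** * Vieta jumps along the tree *)

(** The order conditions only make [x] the largest entry, so as to admit the root triple, where [x]
    is the smaller root. *)
Definition config (R : realType) (a : R) (t : triple R) (p q r x y z : R) : Prop :=
  [/\ half_turn_at a p x t.1.1, half_turn_at a q y t.1.2,
      half_turn_at a r z t.2,
      q - p = a * z / (x * y) /\ r - q = a * x / (y * z) &
      [/\ x ^+ 2 + y ^+ 2 + z ^+ 2 = x * y * z, a <= y, a <= z, y <= x & z <= x]].

(** The new entry is the second root of the equation in [y]. The product [x^2 + z^2] of the two
    roots is what [half_turn_at_conj] asks for. *)
Lemma config_lambda (R : realType) (a : R) t p q r x y z : 2 < a ->
  config a t p q r x y z ->
  exists p', config a (tree_lambda t) p' p r (x * z - y) x z.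
Proof.
move=> a2; case: t => [[E F] G] [/= hE hF hG [qp rq] [mk ay az yx zx]].
have x'x : x <= x * z - y by nra.
have [a0 x0 y0 z0 x'0] : [/\ 0 < a, 0 < x, 0 < y, 0 < z & 0 < x * z - y] by split; lra.
have x'n0 := lt0r_neq0 x'0.
have x'y : (x * z - y) * y = x ^+ 2 + z ^+ 2.
  rewrite mulrBl; have -> : x * z * y = x * y * z by ring.
  by rewrite -mk; ring.
have := half_turn_at_conj a0 x0 y0 x'0 _ hE hF; rewrite x'y qp => /(_ _) hE'.
eexists; split=> /=.
- by apply: hE'; field; rewrite !gt_eqF.
- by [].
- by [].
- split.
    by field; rewrite x'n0 !gt_eqF.
  rewrite -(subrKA q) rq qp -[x * z - y](mulfK (lt0r_neq0 y0)) x'y.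
  by field; rewrite !gt_eqF.
- split=> //; [|lra|lra].
  transitivity ((x * z - y) ^+ 2 + (x * z - y) * y); first by rewrite x'y; ring.
  by ring.
Qed.

Lemma config_rho (R : realType) (a : R) t p q r x y z : 2 < a ->
  config a t p q r x y z ->
  exists p', config a (tree_rho a t) p' q (p + a) (x * y - z) y x.
Proof.
move=> a2; case: t => [[E F] G] [/= hE hF hG [qp rq] [mk ay az yx zx]].
have x'x : x <= x * y - z by nra.
have [a0 x0 y0 z0 x'0] : [/\ 0 < a, 0 < x, 0 < y, 0 < z & 0 < x * y - z] by split; lra.
have x'n0 := lt0r_neq0 x'0.
have x'z : (x * y - z) * z = x ^+ 2 + y ^+ 2.
  by rewrite mulrBl -mk; ring.
have := half_turn_at_conj a0 y0 z0 x'0 _ hF hG; rewrite x'z rq => /(_ _) hE'.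
eexists; split=> /=.
- by apply: hE'; field; rewrite !gt_eqF.
- by [].
- exact: half_turn_at_translate.
- split.
    by field; rewrite x'n0 !gt_eqF.
  rewrite (_ : p + a - q = a - (q - p)); last by ring.
  by rewrite qp; field; rewrite !gt_eqF.
- split=> //; [|lra|lra].
  transitivity ((x * y - z) ^+ 2 + (x * y - z) * z); first by rewrite x'z; ring.
  by ring.
Qed.

(** The jump is in [x] itself, so the new entry is the largest because [2 * x <= y * z] makes [x]
    the smaller root. *)
Lemma config_nu (R : realType) (a : R) t p q r x y z : 2 < a -> 2 * x <= y * z ->
  config a t p q r x y z ->
  exists p', config a (tree_nu a t) p' r (q + a) (y * z - x) z y.
Proof.
move=> a2 xyz; case: t => [[E F] G] [/= hE hF hG [qp rq] [mk ay az yx zx]].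
have x'x : x <= y * z - x by lra.
have [a0 x0 y0 z0 x'0] : [/\ 0 < a, 0 < x, 0 < y, 0 < z & 0 < y * z - x] by split; lra.
have x'n0 := lt0r_neq0 x'0.
have x'_x : (y * z - x) * x = y ^+ 2 + z ^+ 2.
  rewrite mulrBl; have -> : y * z * x = x * y * z by ring.
  by rewrite -mk; ring.
have := half_turn_at_conj a0 y0 x0 x'0 _ hF hE; rewrite x'_x -opprB qp => /(_ _) hE'.
eexists; split=> /=.
- by apply: hE'; field; rewrite !gt_eqF.
- by [].
- exact: half_turn_at_translate.
- split.
    rewrite mulNr mulNr opprK opprD addrA rq.
    rewrite -[x in a * x / (y * z)](mulKf x'n0) x'_x.
    by field; rewrite x'n0 !gt_eqF.
  rewrite (_ : q + a - r = a - (r - q)); last by ring.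
  by rewrite rq; field; rewrite !gt_eqF.
- split=> //; [|lra|lra].
  transitivity ((y * z - x) ^+ 2 + (y * z - x) * x); first by rewrite x'_x; ring.
  by ring.
Qed.

(** * Gaps and their covers *)

(** It runs from the right end of the interval of [S^-a G S^a] to the left end of that of [F], both
    included. *)
Definition gap (R : realType) (a q y r z : R) : set R[i] :=
  excision_line a `&`
  [set w | r - a / 2 + rad a z <= complex.Re w <= q + a / 2 - rad a y].

Lemma dist_planeE (R : realType) (a : R) (z w : R[i]) :
  excision_line a z -> excision_line a w ->
  dist_plane z w = `|complex.Re z - complex.Re w|.
Proof.
case: z w => [z1 z2] [w1 w2]; rewrite /excision_line /dist_plane /= => -> ->.
by rewrite subrr expr0n addr0 sqrtr_sqr.
Qed.

Definition survivors (R : realType) (a b c : R) : set R[i] :=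
  ~` \bigcup_(A in excisors a b c) excision a A.

Lemma survivors_dist (R : realType) (a b c p x : R) A (w : R[i]) :
  0 < a -> 2 <= x -> half_turn_at a p x A -> excisors a b c A ->
  excision_line a w -> survivors a b c w -> rad a x <= `|complex.Re w - (p + a / 2)|.
Proof.
move=> a0 x2 hA cA lw sw; rewrite leNgt; apply/negP => wA.
by apply: sw; exists A => //; rewrite (excisionE a0 x2 hA).
Qed.

Lemma gap_split (R : realType) (a b c : R) t p q r x y z : 2 < a ->
  tree_node a b c t -> config a t p q r x y z ->
  gap a q y r z `&` survivors a b c `<=`
    gap a p x r z `&` survivors a b c `|` gap a q y (p + a) x `&` survivors a b c.
Proof.
move=> a2 tN [hE _ _ _ [_ ay _ yx _]] w [[lw /= /andP[w1 w2]] sw].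
have cE : excisors a b c t.1.1 by right; exists t.
have a0 : 0 < a by lra.
have x2 : 2 <= x by lra.
have := survivors_dist a0 x2 hE cE lw sw.
by rewrite ler_normr => /orP[wE|wE]; [right|left]; do 2!split=> //=; apply/andP; split; lra.
Qed.

Lemma gap_cover (R : realType) (a b c s : R) n t p q r x y z : 2 < a -> 0 < s ->
  tree_node a b c t -> config a t p q r x y z -> y * z <= 2 * x ->
  s_coverable (@dist_plane R) s
    ((a / (1 - 4 / a ^+ 2)) `^ s * leafsum n ((4 / y ^+ 2) `^ s) ((4 / z ^+ 2) `^ s))
    (gap a q y r z `&` survivors a b c).
Proof.
move=> a2 s0; have a0 : 0 < a by lra.
have K0 : 0 <= a / (1 - 4 / a ^+ 2).
  rewrite divr_ge0 ?(ltW a0)// subr_ge0 ler_pdivrMr ?exprn_gt0// mul1r; nra.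
have ge0 (v : R) : 0 <= 4 / v ^+ 2 by rewrite divr_ge0// sqr_ge0.
elim: n t p q r x y z => [|n IH] t p q r x y z tN cN yzx.
  have [_ _ _ [qp rq] [mk ay az yx zx]] := cN.
  rewrite /= -(powRM _ (ge0 _) (ge0 _)) -(powRM _ K0 (mulr_ge0 (ge0 _) (ge0 _))).
  apply: s_coverable1; [exact: ltW|exact: mulr_ge0 K0 (mulr_ge0 (ge0 _) (ge0 _))|].
  move=> v w [[lv /= /andP[v1 v2]] _] [[lw /= /andP[w1 w2]] _].
  rewrite (dist_planeE lv lw); apply: le_trans (gap_length a2 ay az mk yzx).
  by rewrite -rq ler_norml; apply/andP; split; lra.
have [_ _ _ _ [mk ay az yx zx]] := cN.
have [pl cl] := config_lambda a2 cN; have [pr cr] := config_rho a2 cN.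
have [x0 y0 z0] : [/\ 0 < x, 0 < y & 0 < z] by split; lra.
(* As [x >= y z / 2], the weight of [x] is at most the product of the weights of [y] and [z], which
   is the recursion of [leafsum]. *)
have xw : (4 / x ^+ 2) `^ s <= (4 / y ^+ 2) `^ s * (4 / z ^+ 2) `^ s.
  rewrite -powRM//; apply: (ge0_ler_powR (ltW s0)); rewrite ?nnegrE//.
    exact: mulr_ge0.
  have -> : 4 / y ^+ 2 * (4 / z ^+ 2) = 4 / (y * z / 2) ^+ 2.
    by field; rewrite !gt_eqF.
  rewrite ler_pM2l// lef_pV2 ?posrE ?exprn_gt0 ?divr_gt0 ?mulr_gt0//.
  by rewrite ler_sqr ?nnegrE ?divr_ge0 ?mulr_ge0 ?(ltW x0) ?(ltW y0) ?(ltW z0)//; lra.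
have hl := IH _ _ _ _ _ _ _ (tree_node_lambda tN) cl _.
have hr := IH _ _ _ _ _ _ _ (tree_node_rho tN) cr _.
(* Both children satisfy the induction hypothesis: [2 y <= x z] and [2 z <= x y], since [x] is the
   largest entry. *)
apply: (s_coverableS _ (gap_split a2 tN cN) (s_coverableU (hl _) (hr _))); last 2 first.
- nra.
- nra.
by rewrite -mulrDr ler_wpM2l ?powR_ge0//= lerD// leafsum_le// ?powR_ge0.
Qed.

(** * The root triple and the segment [J] *)

Lemma config_root (R : realType) (a b c : R) : 2 < a -> a <= b -> b <= c ->
  a ^+ 2 + b ^+ 2 + c ^+ 2 = a * b * c ->
  config a (root_triple a b c) 0 (a ^+ 2 / (b * c)) (a - b / c) c b a.
Proof.
move=> a2 ab bc markoff.
have [a0 b0 c0] : [/\ 0 < a, 0 < b & 0 < c] by split; lra.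
split=> /=.
- exists (c / a); first by rewrite gtr0_norm// divr_gt0.
  rewrite /T0 /half_turn mul0r expr0n addr0 oppr0; congr mx2.
  by field; rewrite !gt_eqF.
- exists (b / a); first by rewrite gtr0_norm// divr_gt0.
  by rewrite /T1; congr half_turn; field; rewrite !gt_eqF.
- exists 1; first by rewrite gtr0_norm// divff// gt_eqF.
  by rewrite /T2 mulr1.
- split; first by field; rewrite !gt_eqF.
  have -> : a - b / c = (a * b * c - b ^+ 2) / (b * c) by field; rewrite !gt_eqF.
  by rewrite -markoff; field; rewrite !gt_eqF.
- by split; lra.
Qed.

(* The extra point is the left endpoint of [J], which survives because excision
   intervals are open. *)
Lemma segment_J_sub (R : realType) (a b c : R) : 2 < a -> a <= b -> b <= c ->
  a ^+ 2 + b ^+ 2 + c ^+ 2 = a * b * c ->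
  segment_J a b c `\` \bigcup_(A in excisors a b c) excision a A `<=`
    gap a (a ^+ 2 / (b * c)) b (a - b / c) a `&` survivors a b c `|`
    gap a (a - b / c) a (a ^+ 2 / (b * c) + a) b `&` survivors a b c `|`
    [set Complex (- (b / c) + a / 2 - rad a a) (a / 2)].
Proof.
move=> a2 ab bc markoff w [[lw /= /andP[w1 w2]] sw].
have [a0 a2' b2] : [/\ 0 < a, 2 <= a & 2 <= b] by split; lra.
have [_ h1 h2 _ _] := config_root a2 ab bc markoff.
have h2' := half_turn_at_translate (- a) a0 a0 h2.
rewrite (excision_leftE a0 a2' h2) in w2.
rewrite (excision_leftE a0 a2' h2') in w1.
have := survivors_dist a0 b2 h1 _ lw sw; move=> /(_ (or_introl (or_introl erefl))).
have := survivors_dist a0 a2' h2' _ lw sw; move=> /(_ (or_introl (or_intror erefl))).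
have ra := rad_gt0 a0 a2'.
rewrite !ler_normr => /orP[d2|d2]; last first.
  move=> _; right; move: lw w1 d2; case: w {w2 sw} => [u v].
  rewrite /excision_line /= => -> u_ge u_le.
  by congr Complex; lra.
(* Right of the interval of [T1] lies the gap of the [nu] image of the root, left of it the gap of
   the root. *)
move=> /orP[d1|d1]; left; [right|left]; do 2!split=> //=; apply/andP; split; lra.
Qed.

Theorem theorem2 (R : realType) (a b c : R)
    (a_gt2 : 2 < a) (le_ab : a <= b) (le_bc : b <= c) (c_lt : c < a * b / 2)
    (markoff : a ^+ 2 + b ^+ 2 + c ^+ 2 = a * b * c) :
  hausdorff_dim (@dist_plane R)
    (segment_J a b c `\` \bigcup_(A in excisors a b c) excision a A) = 0%:E.
Proof.
apply: hausdorff_dim0 => s e s0 e0.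
have root := config_root a_gt2 le_ab le_bc markoff.
have rootN := tree_node_root a b c; have nuN := tree_node_nu a b c.
have [pl cl] := config_lambda a_gt2 root.
have [pr cr] := config_rho a_gt2 root.
have ba_ge2c : 2 * c <= b * a by lra.
have [pn cn] := config_nu a_gt2 ba_ge2c root.
have a0 : 0 < a by lra.
have K0 : (0 : R) < (a / (1 - 4 / a ^+ 2)) `^ s.
  by rewrite powR_gt0// divr_gt0// subr_gt0 ltr_pdivrMr ?exprn_gt0// mul1r; nra.
have u01 (x : R) : a <= x -> 0 < (4 / x ^+ 2) `^ s < 1.
  move=> ax; have x0 : 0 < x ^+ 2 by rewrite exprn_gt0//; lra.
  have lt1 : 4 / x ^+ 2 < 1 by rewrite ltr_pdivrMr// mul1r; nra.
  rewrite powR_gt0 ?divr_gt0//=; have := gt0_ltr_powR s0 _ _ lt1.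
  by rewrite powR1; apply; rewrite nnegrE// divr_ge0// ltW.
have ac : a <= c by lra.
have sum_le x y : a <= x -> a <= y -> exists M, forall n,
    \sum_(k < n) leafsum k ((4 / x ^+ 2) `^ s) ((4 / y ^+ 2) `^ s) <= M.
  by move=> ax ay; eexists => n; apply: leafsum_sum_le; exact: u01.
have [Ml hl] := sum_le c a ac (lexx a).
have [Mr hr] := sum_le b c le_ab ac.
have [Mn hn] := sum_le a b (lexx a) le_ab.
(* The summands belong to the [lambda] child, the [rho] child and the [nu] image of the root; adding
   them gives one depth that is good for all three. *)
pose f k : R := leafsum k ((4 / c ^+ 2) `^ s) ((4 / a ^+ 2) `^ s)
  + leafsum k ((4 / b ^+ 2) `^ s) ((4 / c ^+ 2) `^ s)
  + leafsum k ((4 / a ^+ 2) `^ s) ((4 / b ^+ 2) `^ s).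
have [k fk] : exists k, f k < e / (a / (1 - 4 / a ^+ 2)) `^ s.
  apply: (@small_term _ _ (Ml + Mr + Mn)); first exact: divr_gt0.
  by move=> n; rewrite !big_split; exact: lerD (lerD (hl n) (hr n)) (hn n).
(* [gap_cover] needs [y z <= 2 x], which fails at the root, where [2 c < a b];
   hence the start from its two children and from its image under [nu]. *)
apply: s_coverableS (subset_trans (segment_J_sub a_gt2 le_ab le_bc markoff)
    (setSU (setSU (gap_split a_gt2 rootN root))))
  (s_coverableU (s_coverableU (s_coverableU
    (gap_cover k a_gt2 s0 (tree_node_lambda rootN) cl _)
    (gap_cover k a_gt2 s0 (tree_node_rho rootN) cr _))
    (gap_cover k a_gt2 s0 nuN cn _))
    (s_coverable1 (ltW s0) (lexx 0) _)); [|nra..|].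
  by rewrite powR0 ?gt_eqF// addr0 -!mulrDr mulrC -ler_pdivlMr// ltW.
by move=> _ _ -> ->; rewrite (@dist_planeE _ a)// subrr normr0.
Qed.
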